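(* Let $p_0$ be a probability distribution on $\mathbb{R}^d$, fix $t>0$, and let $\theta\mapsto M_t(\theta)$, $\theta\in\mathbb{R}^c$, be a differentiable map into symmetric positive definite $d\times d$ matrices. Let $p_t(\cdot;\theta)=p_0*\mathcal N(0,M_t(\theta))$ (the density of $x_0+M_t(\theta)^{1/2}\epsilon$, $x_0\sim p_0$, $\epsilon\sim\mathcal N(0,I)$ independent), and let $e_1,\dots,e_d$ be the standard basis of $\mathbb{R}^d$. Then for every coordinate $j\in\{1,\dots,c\}$ and all $x\in\mathbb{R}^d$, \[ \partial_{\theta_j}\nabla \log p_t(x;\theta)=\frac12\sum_{i=1}^d\partial_r\partial_s\,\nabla\log p_t\big(x+re_i+s\,\partial_{\theta_j}M_t(\theta)\,e_i;\theta\big)\Big|_{r=s=0}+\partial_s\,\nabla\log p_t\big(x+s\,\partial_{\theta_j}M_t(\theta)\,\nabla\log p_t(x;\theta);\theta\big)\Big|_{s=0}. \] Moreover, let $s(x,t,\phi)$ be a parametric vector field and, for each $\theta$, let $\phi^*(\theta)$ be a minimizer over $\phi$ of the loss \[ L(\theta,\phi)=\mathbb{E}_{t\sim\mathrm{Unif}[0,T],x_0\sim p_0,\epsilon\sim\mathcal N(0,I)}\Big[\big\|(I+M_t(\theta))^{-1/2}(\partial_tM_t(\theta))M_t(\theta)^{1/2}\big(M_t(\theta)^{1/2}s(x_0+M_t(\theta)^{1/2}\epsilon,t,\phi)+\epsilon\big)\big\|_2^2\Big], \] where $t\mapsto M_t(\theta)$ satisfies $M_0(\theta)=0$, $\partial_tM_t(\theta)\succ0$.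 Under sufficient model capacity and data (so that $s(\cdot,t,\phi^*(\theta))=\nabla\log p_t(\cdot;\theta)$), for all $x\in\mathbb{R}^d$, \[ \partial_{\theta_j}s(x,t,\phi^*(\theta))=\frac12\sum_{i=1}^d\partial_r\partial_s\, s\big(x+re_i+s\,\partial_{\theta_j}M_t(\theta)e_i,\,t,\,\phi^*(\theta)\big)\Big|_{r=s=0}+\partial_s\, s\big(x+s\,\partial_{\theta_j}M_t(\theta)\,s(x,t,\phi^*(\theta)),\,t,\,\phi^*(\theta)\big)\Big|_{s=0}. \]
   Context: In the displayed formulas, $r$ and $s$ (when used as scalar arguments) are real variables and $\partial_r,\partial_s$ denote derivatives with respect to them at $0$; the dependence on $\theta$ inside $\nabla\log p_t(\cdot;\theta)$ and $s(\cdot,t,\phi^*(\theta))$ on the right-hand sides is held fixed when differentiating in $r,s$. $\nabla$ denotes the gradient with respect to $x$. *)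

(* Defs.v *)
From HB Require Import structures.
From mathcomp Require Import all_boot all_order all_algebra.
From mathcomp Require Import all_classical all_reals all_analysis.
Set Implicit Arguments. Unset Strict Implicit. Unset Printing Implicit Defensive.
Import Order.TTheory GRing.Theory Num.Theory.
Import numFieldNormedType.Exports.
Local Open Scope classical_set_scope.
Local Open Scope ring_scope.

Definition stdb (R : realType) (n : nat) (i : 'I_n) : 'cV[R]_n := delta_mx i 0.

Definition spd (R : realType) (n : nat) (A : 'M[R]_n) : Prop :=
  A^T = A /\ forall v : 'cV[R]_n, v != 0 -> 0 < (v^T *m A *m v) 0 0.

Definition gauss_density (R : realType) (n : nat) (S : 'M[R]_n) (z : 'cV[R]_n) : R :=
  expR (- (1/2) * (z^T *m invmx S *m z) 0 0)
  / Num.sqrt ((2 * pi) ^+ n * \det S).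

(* density of p0 * N(0,S) at x, where p0 is the law of the R^n-valued random
   variable X0 on the probability space (T, P):  x |-> E[ phi_S(x - X0) ] *)
Definition conv_gauss (R : realType) (dT : measure_display) (T : measurableType dT)
  (P : probability T R) (n : nat) (X0 : T -> 'cV[R]_n) (S : 'M[R]_n) (x : 'cV[R]_n) : R :=
  \int[P]_(w in setT) gauss_density S (x - X0 w).

Definition grad (R : realType) (n : nat) (f : 'cV[R]_n -> R) (x : 'cV[R]_n) : 'cV[R]_n :=
  \col_i ('D_(stdb R i) f x).

Definition score (R : realType) (n : nat) (p : 'cV[R]_n -> R) (x : 'cV[R]_n) : 'cV[R]_n :=
  grad (fun y => ln (p y)) x.

Definition rhs (R : realType) (n : nat) (G : 'cV[R]_n -> 'cV[R]_n) (A : 'M[R]_n)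
  (x : 'cV[R]_n) : 'cV[R]_n :=
  (1/2) *: \sum_(i < n)
      derive1 (fun r : R =>
        derive1 (fun s : R => G (x + r *: stdb R i + s *: (A *m stdb R i))) 0) 0
  + derive1 (fun s : R => G (x + s *: (A *m G x))) 0.

(* Main.v *)
(** Write [z = x - X0], [B = S^-1], [y = B z] and let [m] be the expectation
  weighted by [exp (- z^T B z / 2)] and normalised, i.e. the posterior mean.  The
  Gaussian constant cancels in the score, which is [- m y].  Along a curve
  [(S h, x + h v)] with [S' 0 = A], dominated convergence gives
  [(m g)' = m (g' - g q) + m g * m q] with [y' = B v - B A y] and
  [q = v . y - (y . A y) / 2].  Taking [A = 0] gives the spatial derivatives of the
  score as posterior cumulants of [y], taking [v = 0] gives the derivative with
  respect to the covariance; both sides of the identity are then the same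
  polynomial in the moments of [y] of order at most three.  The domination is
  uniform in [h] thanks to the Cauchy-Schwarz bound [|z|^2 <= tr S * (z . B z)]. *)

Require Import Defs.
From HB Require Import structures.
From mathcomp Require Import all_boot all_order all_algebra.
From mathcomp Require Import all_classical all_reals all_analysis.
From mathcomp Require Import measurable_realfun ring lra.
Set Implicit Arguments. Unset Strict Implicit. Unset Printing Implicit Defensive.
Import Order.TTheory GRing.Theory Num.Theory.
Import numFieldNormedType.Exports.
Local Open Scope classical_set_scope.
Local Open Scope ring_scope.

(** * Differentiation under the expectation *)

(** Near 0 the difference quotient lies within 1 of its limit [df]. *)
Lemma is_derive0_Lipschitz (R : realType) (f : R -> R) (df : R) :
  is_derive (0 : R) (1 : R) f df ->
  \forall h \near (0 : R), `|f h - f 0| <= (`|df| + 1) * `|h|.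
Proof.
move=> [dv <-]; move/cvgrPdist_le : (dv) => /(_ 1 ltr01).
move=> -[e /= e0 He]; exists e => //= h he.
have [->|h0] := eqVneq h 0; first by rewrite subrr normr0 mulr0.
have := He h he h0; rewrite scaler1 addr0 => H1.
rewrite -ler_pdivrMr ?normr_gt0// -normfV -normrM mulrC.
by have := le_trans (lerB_dist _ _) (_ : `|_ - 'D_1 f 0| <= 1);
  rewrite -lerBlDl; apply; rewrite distrC.
Qed.

Section under.
Context (R : realType) (dT : measure_display) (T : measurableType dT).
Variable P : probability T R.

Lemma bounded_integrable (f : T -> R) (C : R) :
  measurable_fun setT f -> (forall w, `|f w| <= C) ->
  P.-integrable setT (EFin \o f).
Proof.
move=> mf fC; apply: measurable_bounded_integrable => //.
  by rewrite (le_lt_trans (probability_le1 _ _))// ltry.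
by exists C; split; rewrite ?num_real// => y Cy w _ /=; rewrite (le_trans (fC w))// ltW.
Qed.

(** The Lipschitz bound, uniform in [w], dominates the difference quotients by the constant [C],
    which is integrable for a probability; dominated convergence then exchanges limit and
    integral. *)
Lemma is_derive_integral (F : R -> T -> R) (dF : T -> R) (C : R) :
  (forall h, measurable_fun setT (F h)) ->
  (forall w, is_derive (0 : R) (1 : R) (F^~ w) (dF w)) ->
  (forall w, `|F 0 w| <= C) ->
  (\forall h \near (0 : R), forall w, `|F h w - F 0 w| <= C * `|h|) ->
  is_derive (0 : R) (1 : R) (fun h => \int[P]_w F h w) (\int[P]_w dF w).
Proof.
move=> mF FdF F0C FC.
suff : h^-1 *: (\int[P]_w F (h *: 1 + 0) w - \int[P]_w F 0 w) @[h --> 0^']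
    --> \int[P]_w dF w.
  by move=> cv; apply: DeriveDef; [exact: cvgP cv|exact: cvg_lim cv].
(* The punctured limit is tested on sequences [u] tending to 0 and avoiding 0, the form in which
   dominated convergence applies. *)
apply/cvgr_dnbhsP => u [u0 ucv].
have [N _ HN] : \forall n \near \oo, forall w, `|F (u n) w - F 0 w| <= C * `|u n|.
  exact: (ucv _ FC).
(* Dropping the first [N] terms makes the Lipschitz bound valid at every index. *)
rewrite -(cvg_shiftn N) /=.
pose G n w := (u (n + N)%N)^-1 * (F (u (n + N)%N) w - F 0 w).
have GC n w : `|G n w| <= C.
  rewrite normrM normfV ler_pdivrMl ?normr_gt0// mulrC.
  by apply: HN => /=; exact: leq_addl.
have mG n : measurable_fun setT (G n).
  by apply: measurable_funM => //; exact: measurable_funB.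
have GdF w : G n w @[n --> \oo] --> dF w.
  have [dv dE] := FdF w.
  have : h^-1 *: (F (h *: 1 + 0) w - F 0 w) @[h --> 0^'] --> dF w.
    by rewrite -dE; exact: dv.
  have -> : (fun h => h^-1 *: (F (h *: 1 + 0) w - F 0 w)) =
      (fun h => h^-1 * (F h w - F 0 w)).
    by apply/funext => h; rewrite [h *: 1]mulr1 addr0.
  move/cvgr_dnbhsP/(_ (fun n => u (n + N)%N)); apply.
  by split => //; rewrite (cvg_shiftn N).
(* Measurability of [dF] is inherited from the quotients, of which it is the pointwise limit. *)
have mdF : measurable_fun setT dF.
  apply: (@measurable_fun_cvg _ _ _ _ G) => //.
have IF n : P.-integrable setT (EFin \o F (u (n + N)%N)).
  apply: (@bounded_integrable _ (C * `|u (n + N)%N| + C)) => // w.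
  rewrite -(subrK (F 0 w) (F _ w)) (le_trans (ler_normD _ _))// lerD//.
  by apply: HN => /=; exact: leq_addl.
have IF0 : P.-integrable setT (EFin \o F 0) by apply: (@bounded_integrable _ C).
have [IdF _ /= DC] := @dominated_convergence _ T R P setT measurableT
  (fun n => EFin \o G n) (EFin \o dF) (cst C%:E)
  (fun n => proj2 (measurable_EFinP _ _) (mG n)) (proj2 (measurable_EFinP _ _) mdF)
  ltac:(by apply: aeW => w _; apply: cvg_EFin; [exact: nearW|exact: GdF])
  ltac:(by apply: finite_measure_integrable_cst)
  ltac:(by apply: aeW => w n _; rewrite lee_fin).
have : fine (\int[P]_w (G n w)%:E)%E @[n --> \oo] --> fine (\int[P]_w (dF w)%:E)%E.
  apply: fine_cvg; rewrite fineK//.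
  exact: integrable_fin_num.
apply: cvg_trans; apply: near_eq_cvg; near=> n.
have -> : u (n + N)%N *: 1 + 0 = u (n + N)%N by rewrite addr0 [LHS]mulr1.
rewrite -RintegralB// [RHS]mulrC -RintegralZr//.
  by apply: eq_Rintegral => w _; rewrite mulrC.
exact: (integrableB measurableT (IF n) IF0).
Unshelve. all: by end_near. Qed.

End under.

(** * Domination by Gaussian weights *)

(** From [1 + y <= expR y] at [y = lam * x / (k + 1)], [x] is at most [(k + 1) / lam * expR y]. In
    the [k]-th power the exponent is [k / (k + 1) * (lam * x)], at most [lam * x]. Dividing by
    [k + 1] covers [k = 0] as well. *)
Lemma exprn_expRN_bounded (R : realType) (k : nat) (lam : R) : 0 < lam ->
  exists C : R, forall x, 0 <= x -> x ^+ k * expR (- (lam * x)) <= C.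
Proof.
move=> lam0; exists ((k.+1%:R / lam) ^+ k) => x x0.
have n0 : 0 < k.+1%:R :> R by rewrite ltr0n.
rewrite expRN ler_pdivrMr ?expR_gt0//.
have y0 : 0 <= lam * x / k.+1%:R by rewrite divr_ge0// mulr_ge0// ltW.
have xle : x <= k.+1%:R / lam * expR (lam * x / k.+1%:R).
  rewrite -ler_pdivrMl ?divr_gt0// invf_div mulrAC.
  by apply: le_trans (expR_ge1Dx _); rewrite ler_wpDl.
apply: (@le_trans _ _ ((k.+1%:R / lam) ^+ k * expR (lam * x / k.+1%:R) ^+ k)).
  by rewrite -exprMn lerXn2r// nnegrE (le_trans x0).
rewrite ler_wpM2l ?exprn_ge0 ?divr_ge0 ?(ltW n0) ?(ltW lam0)//.
rewrite -expRM_natr ler_expR -mulrA ler_piMr ?mulr_ge0 ?(ltW lam0)//.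
by rewrite ler_pdivrMl// mulr1 ler_nat.
Qed.

(** By symmetry [a <= b]; after factoring out [expR (- a)], what remains is
    [1 - expR (a - b) <= b - a]. *)
Lemma dist_expRN_le (R : realType) (a b m : R) : m <= a -> m <= b ->
  `|expR (- a) - expR (- b)| <= `|a - b| * expR (- m).
Proof.
wlog ab : a b / a <= b => [H ma mb|ma mb].
  have [ab|/ltW ba] := leP a b; first exact: H.
  by rewrite distrC (distrC a); exact: H.
rewrite ger0_norm ?subr_ge0 ?ler_expR ?lerN2// ler0_norm ?subr_le0// opprB.
have -> : expR (- b) = expR (- a) * expR (a - b) by rewrite -expRD addKr.
have -> : expR (- a) - expR (- a) * expR (a - b) = (1 - expR (a - b)) * expR (- a) by ring.
apply: ler_pM; rewrite ?expR_ge0 ?ler_expR ?lerN2//.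
  by rewrite subr_ge0 -expR0 ler_expR subr_le0.
by have := expR_ge1Dx (a - b); lra.
Qed.

(** * Calculus of integrands with polynomially bounded growth and Lipschitz constants *)

Section admissible.
Context (R : realType) (dT : measure_display) (T : measurableType dT).
Variables (P : probability T R) (W : T -> R).
Hypothesis W1 : forall w, 1 <= W w.

Definition poly_growth (f : T -> R) :=
  exists (k : nat) (C : R), 0 <= C /\ forall w, `|f w| <= C * W w ^+ k.

(* [f] is differentiable at [h = 0] and Lipschitz there with a constant of
   polynomial growth in [W], so that [f * expR (- Q)] has dominated difference
   quotients as soon as [Q >= lam * W - K]. *)
Definition adm (f : R -> T -> R) (df : T -> R) :=
  [/\ forall h, measurable_fun setT (f h),
      forall w, is_derive (0 : R) (1 : R) (f^~ w) (df w),
      poly_growth (f 0) &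
      exists (k : nat) (C : R), 0 <= C /\
        \forall h \near (0 : R), forall w, `|f h w - f 0 w| <= C * W w ^+ k * `|h|].

Lemma W_ge0 w : 0 <= W w. Proof. exact: le_trans (W1 w). Qed.

(** Since [W >= 1], its powers increase with the exponent, so bounds of different degrees merge
    under the larger one. *)
Lemma ler_growth k l C D w : (k <= l)%N -> 0 <= C -> C <= D ->
  C * W w ^+ k <= D * W w ^+ l.
Proof.
move=> kl C0 CD; apply: ler_pM => //; first by rewrite exprn_ge0 ?W_ge0.
by rewrite ler_weXn2l.
Qed.

Lemma poly_growthD f g : poly_growth f -> poly_growth g ->
  poly_growth (fun w => f w + g w).
Proof.
move=> [k [C [C0 fC]]] [l [D [D0 gD]]]; exists (maxn k l), (C + D).
split => [|w]; first exact: addr_ge0.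
rewrite (le_trans (ler_normD _ _))// mulrDl lerD//.
  by rewrite (le_trans (fC w))// ler_growth ?leq_maxl.
by rewrite (le_trans (gD w))// ler_growth ?leq_maxr.
Qed.

Lemma poly_growthM f g : poly_growth f -> poly_growth g ->
  poly_growth (fun w => f w * g w).
Proof.
move=> [k [C [C0 fC]]] [l [D [D0 gD]]]; exists (k + l)%N, (C * D).
split => [|w]; first exact: mulr_ge0.
by rewrite normrM exprD mulrACA ler_pM.
Qed.

Lemma poly_growth_cst c : poly_growth (fun=> c).
Proof. by exists 0%N, `|c|; split => // w; rewrite expr0 mulr1. Qed.

Lemma adm_cst (c : R -> R) dc : is_derive (0 : R) (1 : R) c dc ->
  adm (fun h _ => c h) (fun=> dc).
Proof.
move=> H; split => //; first exact: poly_growth_cst.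
exists 0%N, (`|dc| + 1); split => [|]; first by rewrite addr_ge0.
have := is_derive0_Lipschitz H; apply: filterS => h Hh w.
by rewrite expr0 mulr1.
Qed.

Lemma adm_fixed g : measurable_fun setT g -> poly_growth g ->
  adm (fun=> g) (fun=> 0).
Proof.
move=> mg pg; split => // [w|]; first exact: is_derive_cst.
by exists 0%N, 0; split => //; apply: (@nearW _ (nbhs (0 : R))) => h w; rewrite subrr normr0 !mul0r.
Qed.

Lemma admD f df g dg : adm f df -> adm g dg ->
  adm (fun h w => f h w + g h w) (fun w => df w + dg w).
Proof.
move=> [mf Df pf [k [C [C0 fC]]]] [mg Dg pg [l [D [D0 gD]]]]; split.
- by move=> h; exact: measurable_funD.
- by move=> w; exact: is_deriveD.
- exact: poly_growthD.
exists (maxn k l), (C + D); split; first exact: addr_ge0.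
near=> h => w; rewrite opprD addrACA (le_trans (ler_normD _ _))// !mulrDl lerD//.
  have fCh := near fC h; apply: (le_trans (fCh _ w)) => //.
  by rewrite ler_wpM2r// ler_growth ?leq_maxl.
have gDh := near gD h; apply: (le_trans (gDh _ w)) => //.
by rewrite ler_wpM2r// ler_growth ?leq_maxr.
Unshelve. all: by end_near. Qed.

(** The increment of the product is split as [f 0 * (g h - g 0) + (f h - f 0) * (g 0 + (g h - g
    0))]. The two summands account for the two terms of the Lipschitz constant and for the two
    degrees under the maximum; [|h| <= 1] bounds the inner increment of [g] without a factor
    [|h|]. *)
Lemma admM f df g dg : adm f df -> adm g dg ->
  adm (fun h w => f h w * g h w) (fun w => f 0 w * dg w + df w * g 0 w).
Proof.
move=> [mf Df pf [k [C [C0 fC]]]] [mg Dg pg [l [D [D0 gD]]]].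
have [kf [Cf [Cf0 f0C]]] := pf; have [kg [Cg [Cg0 g0C]]] := pg; split.
- by move=> h; exact: measurable_funM.
- by move=> w; apply: is_derive_eq; rewrite [df w * _]mulrC.
- exact: poly_growthM.
exists (maxn (kf + l) (k + (maxn kg l))), (Cf * D + C * (Cg + D)).
split; first by rewrite !(addr_ge0, mulr_ge0).
near=> h => w.
have h1 : `|h| <= 1 by near: h; exists 1 => //= y; rewrite /ball/= sub0r normrN => /ltW.
have fh : `|f h w - f 0 w| <= C * W w ^+ k * `|h| by have := near fC h; exact.
have gh : `|g h w - g 0 w| <= D * W w ^+ l * `|h| by have := near gD h; exact.
have -> : f h w * g h w - f 0 w * g 0 w =
  f 0 w * (g h w - g 0 w) + (f h w - f 0 w) * (g 0 w + (g h w - g 0 w)) by ring.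
have WX n : 0 <= W w ^+ n by rewrite exprn_ge0 ?W_ge0.
rewrite (le_trans (ler_normD _ _))// [X in _ <= X * _]mulrDl [leRHS]mulrDl lerD// normrM.
  apply: (@le_trans _ _ (Cf * W w ^+ kf * (D * W w ^+ l * `|h|))).
    by rewrite ler_pM.
  rewrite mulrA ler_wpM2r// mulrACA -exprD ler_growth ?leq_maxl ?mulr_ge0//.
apply: (@le_trans _ _ (C * W w ^+ k * `|h| * ((Cg + D) * W w ^+ (maxn kg l)))).
  apply: ler_pM => //; rewrite (le_trans (ler_normD _ _))// mulrDl lerD//.
    by rewrite (le_trans (g0C w))// ler_growth ?leq_maxl.
  rewrite (le_trans gh)// (@le_trans _ _ (D * W w ^+ l))// ?ler_growth ?leq_maxr//.
  by rewrite ler_piMr ?mulr_ge0.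
rewrite mulrAC ler_wpM2r// mulrACA -exprD ler_growth ?leq_maxr// ?mulr_ge0 ?addr_ge0//.
Unshelve. all: by end_near. Qed.

Lemma adm_sum n (f : 'I_n -> R -> T -> R) df : (forall i, adm (f i) (df i)) ->
  adm (fun h w => \sum_(i < n) f i h w) (fun w => \sum_(i < n) df i w).
Proof.
elim: n f df => [|n IH] f df H.
  rewrite (_ : (fun _ _ => _) = fun _ _ => 0); last first.
    by apply/funext => h; apply/funext => w; rewrite big_ord0.
  rewrite (_ : (fun _ => \sum__ _) = fun=> 0); last first.
    by apply/funext => w; rewrite big_ord0.
  by apply: adm_fixed => //; exact: poly_growth_cst.
rewrite (_ : (fun _ _ => _) =
    fun h w => \sum_(i < n) f (widen_ord (leqnSn n) i) h w + f ord_max h w); last first.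
  by apply/funext => h; apply/funext => w; rewrite big_ord_recr.
rewrite (_ : (fun _ => \sum__ _) =
    fun w => \sum_(i < n) df (widen_ord (leqnSn n) i) w + df ord_max w); last first.
  by apply/funext => w; rewrite big_ord_recr.
by apply: admD => //; exact: (IH (fun i => f (widen_ord (leqnSn n) i))).
Qed.

(** * Integrals against a weight [expR (- Q)] with coercive [Q] *)

Section expint.
Variables (lam K : R).
Hypothesis lam0 : 0 < lam.

(** The exponential decay in [W] beats the polynomial growth. The bound holds for every [q] above
    the coercive minorant, so one constant serves all parameters [h]. *)
Lemma growth_exp_bounded g : poly_growth g ->
  exists C, forall w q, lam * W w - K <= q -> `|g w| * expR (- q) <= C.
Proof.
move=> [k [C [C0 gC]]]; have [D HD] := @exprn_expRN_bounded R k lam lam0.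
exists (C * D * expR K) => w q Hq.
apply: (@le_trans _ _ (C * W w ^+ k * (expR (- (lam * W w)) * expR K))).
  apply: ler_pM; rewrite ?expR_ge0// -expRD ler_expR; lra.
rewrite mulrA ler_wpM2r ?expR_ge0// -mulrA ler_wpM2l//.
by apply: HD; exact: W_ge0.
Qed.

Lemma integrable_growth_exp g q : measurable_fun setT g -> poly_growth g ->
  measurable_fun setT q -> (forall w, lam * W w - K <= q w) ->
  P.-integrable setT (EFin \o (fun w => g w * expR (- q w))).
Proof.
move=> mg pg mq Hq; have [C HC] := growth_exp_bounded pg.
apply: (@bounded_integrable _ _ _ _ _ C) => [|w].
  apply: measurable_funM => //; apply: measurableT_comp => //.
  exact: measurable_funN.
by rewrite normrM (ger0_norm (expR_ge0 _)) HC.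
Qed.

Lemma is_derive_expint f df Q dQ : adm f df -> adm Q dQ ->
  (\forall h \near (0 : R), forall w, lam * W w - K <= Q h w) ->
  is_derive (0 : R) (1 : R) (fun h => \int[P]_w (f h w * expR (- Q h w)))
   (\int[P]_w ((df w - f 0 w * dQ w) * expR (- Q 0 w))).
Proof.
move=> [mf Df pf [k [C [C0 fC]]]] [mQ DQ pQ [l [D [D0 QD]]]] HQ.
have HQ0 : forall w, lam * W w - K <= Q 0 w by exact: nbhs_singleton HQ.
have [C1 HC1] := growth_exp_bounded pf.
(* The Lipschitz constants of [f] and of [Q] (the latter multiplied by [f 0]) are bounded together,
   at the worst exponent [q = lam * W w - K]. *)
have [C2 HC2] : exists C2, forall w q, lam * W w - K <= q ->
    `|C * W w ^+ k + `|f 0 w| * (D * W w ^+ l)| * expR (- q) <= C2.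
  apply: growth_exp_bounded; apply: poly_growthD.
    by exists k, C; split => // w; rewrite ger0_norm ?mulr_ge0 ?exprn_ge0 ?W_ge0.
  apply: poly_growthM.
    have [k' [C' [C'0 H]]] := pf.
    by exists k', C'; split => // w; rewrite normr_id.
  by exists l, D; split => // w; rewrite ger0_norm ?mulr_ge0 ?exprn_ge0 ?W_ge0.
apply: (@is_derive_integral _ _ _ _ _ _ (Num.max C1 C2)) => [h|w|w|].
- apply: measurable_funM => //; apply: measurableT_comp => //.
  exact: measurable_funN.
- have := is_deriveN (DQ w) => DNQ.
  have H : is_derive (0 : R) (1 : R) (fun h => expR (- Q h w))
      (expR (- Q 0 w) * - dQ w).
    exact: (@is_derive1_comp _ expR (- (Q^~ w))).
  apply: is_derive_eq; rewrite /GRing.scale/=; ring.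
- by rewrite normrM (ger0_norm (expR_ge0 _)) le_max HC1.
near=> h => w.
have fh : `|f h w - f 0 w| <= C * W w ^+ k * `|h| by have := near fC h; exact.
have Qh : `|Q h w - Q 0 w| <= D * W w ^+ l * `|h| by have := near QD h; exact.
have HQh : lam * W w - K <= Q h w by have := near HQ h; exact.
have WX n : 0 <= W w ^+ n by rewrite exprn_ge0 ?W_ge0.
(* One factor varies at a time; both resulting terms carry a weight at most
   [expR (- (lam * W w - K))]. *)
have -> : f h w * expR (- Q h w) - f 0 w * expR (- Q 0 w) =
  (f h w - f 0 w) * expR (- Q h w) + f 0 w * (expR (- Q h w) - expR (- Q 0 w)) by ring.
have E := dist_expRN_le HQh (HQ0 w).
apply: (@le_trans _ _ (C2 * `|h|)); last by rewrite ler_wpM2r// le_max lexx orbT.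
apply: le_trans; last first.
  by apply: ler_wpM2r; [exact: normr_ge0|exact: (HC2 w _ (lexx _))].
rewrite [X in X * _ * _]ger0_norm; last by rewrite !(addr_ge0, mulr_ge0).
rewrite (le_trans (ler_normD _ _))// [X in _ <= X * _]mulrDl [leRHS]mulrDl lerD// normrM.
  rewrite (ger0_norm (expR_ge0 _)) mulrAC ler_pM ?expR_ge0//.
  by rewrite ler_expR lerN2.
rewrite -!mulrA ler_wpM2l// (le_trans E)// mulrA mulrA mulrAC ler_wpM2r ?expR_ge0//.
Unshelve. all: by end_near. Qed.

End expint.
End admissible.

(** * Positive definite matrices and derivatives of inverses *)

Section dot.
Context (R : realType) (n : nat).
Implicit Types a b c : 'cV[R]_n.

(** A sum over coordinates rather than a matrix product, so that [adm_sum] and [admM] apply to it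
    directly. *)
Definition dot a b : R := \sum_i a i 0 * b i 0.

Lemma dotE a b : dot a b = (a^T *m b) 0 0.
Proof. by rewrite mxE; apply: eq_bigr => i _; rewrite mxE. Qed.

Lemma quadE a (S : 'M[R]_n) b : (a^T *m S *m b) 0 0 = dot a (S *m b).
Proof. by rewrite dotE mulmxA. Qed.

Lemma dotC a b : dot a b = dot b a.
Proof. by apply: eq_bigr => i _; rewrite mulrC. Qed.

Lemma dotDr a b c : dot a (b + c) = dot a b + dot a c.
Proof. by rewrite !dotE mulmxDr mxE. Qed.

Lemma dotZr a k b : dot a (k *: b) = k * dot a b.
Proof. by rewrite !dotE -scalemxAr mxE. Qed.

Lemma dotNr a b : dot a (- b) = - dot a b.
Proof. by rewrite -scaleN1r dotZr mulN1r. Qed.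

Lemma dotBr a b c : dot a (b - c) = dot a b - dot a c.
Proof. by rewrite dotDr dotNr. Qed.

Lemma dotZl a k b : dot (k *: a) b = k * dot a b.
Proof. by rewrite dotC dotZr dotC. Qed.

Lemma dotBl a b c : dot (a - b) c = dot a c - dot b c.
Proof. by rewrite dotC dotBr dotC (dotC c). Qed.

Lemma dot0r a : dot a 0 = 0.
Proof. by rewrite dotE mulmx0 mxE. Qed.

Lemma dot_sumr a m (f : 'I_m -> 'cV[R]_n) :
  dot a (\sum_k f k) = \sum_k dot a (f k).
Proof. by rewrite dotE mulmx_sumr summxE; apply: eq_bigr => k _; rewrite dotE. Qed.

Lemma dot_mulmx (S : 'M[R]_n) a b : dot a (S *m b) = dot (S^T *m a) b.
Proof. by rewrite !dotE trmx_mul trmxK mulmxA. Qed.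

Lemma dot_stdb i b : dot (stdb R i) b = b i 0.
Proof.
rewrite /dot (bigD1 i)//= big1 ?addr0 ?mxE ?eqxx ?mul1r// => j ji.
by rewrite mxE (negbTE ji) mul0r.
Qed.

Lemma sum_dot_stdb b : b = \sum_k dot b (stdb R k) *: stdb R k.
Proof.
apply/matrixP => i j; rewrite (ord1 j) summxE (bigD1 i)//= big1 ?addr0.
  by rewrite mxE dotC dot_stdb mxE !eqxx mulr1.
by move=> k ki; rewrite !mxE eq_sym (negbTE ki) mulr0.
Qed.

End dot.

Section spd.
Context (R : realType) (n : nat).
Variable S : 'M[R]_n.
Hypothesis hS : spd S.

Lemma spd_det_neq0 : \det S != 0.
Proof.
apply/negP => /det0P[v v0 vS].
have [_ /(_ v^T)] := hS; rewrite trmxK vS mul0mx mxE ltxx => H.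
by have : false by apply: H; rewrite -(trmxK v) in v0; apply: contra_neq v0 => ->; rewrite trmx0.
Qed.

Lemma spd_unitmx : S \in unitmx.
Proof. by rewrite unitmxE unitfE spd_det_neq0. Qed.

Lemma spd_inv_sym : (invmx S)^T = invmx S.
Proof. by have [E _] := hS; rewrite trmx_inv E. Qed.

Lemma spd_ge0 v : 0 <= dot v (S *m v).
Proof.
have [->|v0] := eqVneq v 0; first by rewrite mulmx0 dot0r.
by have [_ /(_ v v0)] := hS; rewrite quadE => /ltW.
Qed.

Lemma spd_diag_gt0 i : 0 < S i i.
Proof.
have [_ /(_ (stdb R i))] := hS; rewrite quadE dot_stdb -colE mxE; apply.
apply/eqP => /matrixP/(_ i 0); rewrite !mxE !eqxx => /eqP.
by rewrite oner_eq0.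
Qed.

Lemma spd_tr_ge0 : 0 <= \tr S.
Proof. by apply: sumr_ge0 => i _; rewrite ltW// spd_diag_gt0. Qed.

(* Cauchy-Schwarz for the inner product of [S], applied to the [i]-th basis
   vector and [invmx S *m z] *)
Lemma sqr_coord_le_spd_inv (z : 'cV[R]_n) i : z i 0 ^+ 2 <= S i i * dot z (invmx S *m z).
Proof.
set y := invmx S *m z; have Sy : S *m y = z by rewrite mulKVmx ?spd_unitmx.
(* This [t] minimises the quadratic form of [S] along the line [y - t *: stdb R i]. *)
pose t := z i 0 / S i i; have Sii := spd_diag_gt0 i.
have := spd_ge0 (y - t *: stdb R i).
rewrite mulmxBr Sy -scalemxAr dotBr dotZr !dotBl !dotZl !dot_stdb -colE mxE.
rewrite (dotC y z) [dot y _]dotC.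
have -> : dot (col i S) y = z i 0.
  by have [E _] := hS; rewrite colE -{1}E -dot_mulmx Sy dot_stdb.
rewrite (_ : _ - _ = dot z y - z i 0 ^+ 2 / S i i).
  by rewrite subr_ge0 ler_pdivrMr// mulrC.
by rewrite /t; field; rewrite gt_eqF.
Qed.

(** A lower bound for the form of the inverse through the trace of [S], a quantity continuous along
    a curve of matrices; this makes the domination uniform. *)
Lemma sum_sqr_le_spd_inv (z : 'cV[R]_n) :
  \sum_i z i 0 ^+ 2 <= \tr S * dot z (invmx S *m z).
Proof.
by rewrite /mxtrace mulr_suml; apply: ler_sum => i _; exact: sqr_coord_le_spd_inv.
Qed.

Lemma spd_inv_ge0 z : 0 <= dot z (invmx S *m z).
Proof.
have := spd_ge0 (invmx S *m z).
by rewrite mulKVmx ?spd_unitmx// dotC.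
Qed.

(** Homotopy to the identity: the determinant of [S + s *: (1%:M - S)] is a polynomial in [s] with
    value 1 at [s = 1]. Were it negative at [s = 0], it would vanish on [0, 1], and a kernel vector
    [u] would annihilate the positive quantity [(1 - s) * dot u (S *m u) + s * dot u u]. *)
Lemma spd_det_gt0 : 0 < \det S.
Proof.
rewrite lt_neqAle eq_sym spd_det_neq0 /= leNgt; apply/negP => d0.
pose M := map_mx polyC S + 'X *: map_mx polyC (1%:M - S) : 'M[{poly R}]_n.
have ME s : (\det M).[s] = \det (S + s *: (1%:M - S)).
  rewrite -/(horner_eval s (\det M)) -det_map_mx; congr (\det _).
  by apply/matrixP => i j; rewrite !mxE /= /horner_eval hornerD hornerM hornerX !hornerC.
have [|s /andP[s0 s1]] := @poly_ivt R (\det M) 0 1 ler01.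
  by rewrite !ME scale0r addr0 scale1r addrC subrK det1 (ltW d0) ler01.
rewrite rootE ME => /det0P[v v0 vS].
have u0 : v^T != 0 by rewrite -(trmxK v) in v0; apply: contra_neq v0 => ->; rewrite trmx0.
move: vS; rewrite -(trmxK v); move: v^T u0 => u u0 {v v0} uS.
have [_ /(_ _ u0)] := hS; rewrite quadE => q0.
have u2 : 0 < dot u u.
  rewrite lt_neqAle sumr_ge0 => [|i _]; last exact: sqr_ge0.
  rewrite andbT eq_sym psumr_eq0; last by move=> i _; exact: sqr_ge0.
  apply: contra u0 => /allP H; apply/eqP/matrixP => i j; rewrite (ord1 j).
  by have := H i (mem_index_enum i); rewrite -expr2 sqrf_eq0 => /eqP ->; rewrite mxE.
have : (u^T *m (S + s *: (1%:M - S)) *m u) 0 0 = 0 by rewrite uS mul0mx mxE.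
rewrite quadE mulmxDl -scalemxAl mulmxBl mul1mx dotDr dotZr dotBr => H.
suff : 0 < (1 - s) * dot u (S *m u) + s * dot u u.
  rewrite (_ : _ + _ = 0) ?ltxx//; rewrite -[RHS]H; ring.
(* At [s = 0] positivity comes from the first term, otherwise from the second. *)
have [->|s0'] := eqVneq s 0; first by rewrite subr0 mul1r mul0r addr0.
apply: ltr_wpDl; first by rewrite mulr_ge0 ?subr_ge0// ltW.
by rewrite mulr_gt0// lt_neqAle eq_sym s0'.
Qed.

End spd.

(** * Derivative of the matrix inverse *)

Section derive_inverse.
Context (R : realType).

Lemma derivable_prod (I : Type) (r : seq I) (F : I -> R -> R) (x v : R) :
  (forall i, derivable (F i) x v) ->
  derivable (fun h => \prod_(i <- r) F i h) x v.
Proof.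
move=> dF; elim: r => [|i r IH].
  by under eq_fun do rewrite big_nil; exact: derivable_cst.
by under eq_fun do rewrite big_cons; exact: derivableM.
Qed.

Lemma derivable_bigsum (I : Type) (r : seq I) (F : I -> R -> R) (x v : R) :
  (forall i, derivable (F i) x v) ->
  derivable (fun h => \sum_(i <- r) F i h) x v.
Proof.
move=> dF; elim: r => [|i r IH].
  by under eq_fun do rewrite big_nil; exact: derivable_cst.
by under eq_fun do rewrite big_cons; exact: derivableD.
Qed.

Lemma derivable_det n (M : R -> 'M[R]_n) (x v : R) :
  (forall i j, derivable (fun h => M h i j) x v) ->
  derivable (fun h => \det (M h)) x v.
Proof.
move=> dM; rewrite /determinant; apply: derivable_bigsum => s.
by apply: derivableM; [exact: derivable_cst|exact: derivable_prod].
Qed.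

(** By the cofactor formula each entry of the inverse is a quotient of determinants, which are
    polynomial in the entries of [M]. *)
Lemma derivable_invmx n (M : R -> 'M[R]_n) (x v : R) :
  (forall h, M h \in unitmx) ->
  (forall i j, derivable (fun h => M h i j) x v) ->
  forall i j, derivable (fun h => invmx (M h) i j) x v.
Proof.
move=> uM dM i j.
have -> : (fun h => invmx (M h) i j) =
    (fun h => (\det (M h))^-1 * ((-1) ^+ (j + i) * \det (row' j (col' i (M h))))).
  by apply/funext => h; rewrite /invmx uM !mxE.
apply: derivableM.
  apply: derivableV; first by have := uM x; rewrite unitmxE unitfE.
  exact: derivable_det.
apply: derivableM; first exact: derivable_cst.
by apply: derivable_det => k l; under eq_fun do rewrite !mxE; exact: dM.
Qed.

Lemma is_derive_bigsum n (F : 'I_n -> R -> R) dF (x v : R) :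
  (forall i, is_derive x v (F i) (dF i)) ->
  is_derive x v (fun h => \sum_(i < n) F i h) (\sum_(i < n) dF i).
Proof.
move=> H; have := is_derive_sum H.
by rewrite (_ : \sum_(i < n) F i = fun h => \sum_(i < n) F i h)//;
  apply/funext => h; rewrite fct_sumE.
Qed.

(** Once the inverse is known to be derivable, the product rule on [M h *m invmx (M h) = 1%:M] gives
    a linear equation for its derivative [B']. *)
Lemma is_derive_invmx n (M : R -> 'M[R]_n) (A : 'M[R]_n) (x v : R) :
  (forall h, M h \in unitmx) ->
  (forall i j, is_derive x v (fun h => M h i j) (A i j)) ->
  forall i j, is_derive x v (fun h => invmx (M h) i j)
    (- (invmx (M x) *m A *m invmx (M x)) i j).
Proof.
move=> uM dM.
have dB : forall i j, derivable (fun h => invmx (M h) i j) x v.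
  by apply: derivable_invmx => // i j; have [] := dM i j.
pose B' := \matrix_(i, j) 'D_v (fun h => invmx (M h) i j) x.
suff E : B' = - (invmx (M x) *m A *m invmx (M x)).
  move=> i j; apply: DeriveDef; first exact: dB.
  by move/matrixP : E => /(_ i j); rewrite mxE => ->; rewrite mxE.
have E0 : M x *m B' + A *m invmx (M x) = 0.
  apply/matrixP => i j; rewrite !mxE -big_split/=.
  have H : is_derive x v (fun h => \sum_k M h i k * invmx (M h) k j)
    (\sum_k (M x i k * B' k j + A i k * invmx (M x) k j)).
    apply: is_derive_bigsum => k; have dMk := dM i k.
    have dBk := derivableP (dB k j).
    by apply: is_derive_eq; rewrite mxE [A _ _ * _]mulrC.
  have [_ <-] := H.
  rewrite (_ : (fun h => _) = cst ((1%:M : 'M[R]_n) i j)) ?derive_cst//.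
  by apply/funext => h; rewrite /cst -(mulmxV (uM h)) mxE.
have : invmx (M x) *m (M x *m B' + A *m invmx (M x)) = 0 by rewrite E0 mulmx0.
by rewrite mulmxDr mulKmx// mulmxA => /eqP; rewrite addr_eq0 => /eqP.
Qed.

End derive_inverse.

(** * Posterior means along a curve *)

(** A zero integral would make [f] vanish almost everywhere, so the whole space would lie in a null
    set. *)
Lemma Rintegral_gt0 (R : realType) (dT : measure_display) (T : measurableType dT)
  (P : probability T R) (f : T -> R) : P.-integrable setT (EFin \o f) ->
  (forall w, 0 < f w) -> 0 < \int[P]_w f w.
Proof.
move=> If f0; rewrite lt_neqAle Rintegral_ge0 ?andbT; last by move=> w _; rewrite ltW.
apply/negP => /eqP I0.
have mf : measurable_fun setT (EFin \o f) by case/integrableP : If.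
have /(ae_eq_integral_abs P measurableT mf) : (\int[P]_w `|(EFin \o f) w| = 0)%E.
  under eq_integral => w _ do rewrite /= ger0_norm ?(ltW (f0 _))//.
  rewrite -[LHS]fineK; last exact: integrable_fin_num.
  by rewrite -[fine _]/(Rintegral P setT f) -I0.
move=> [N [mN N0 NT]].
have := probability_le1 P mN.
have : (P setT <= P N)%E.
  apply: le_measure; rewrite ?inE// => w _; apply: NT => /= H.
  by have := H I => -[] fw; have := f0 w; rewrite fw ltxx.
by rewrite N0 probability_setT lee_fin ler10.
Qed.

Section mean.
Context (R : realType) (dT : measure_display) (T : measurableType dT).
Variables (P : probability T R) (d : nat) (X0 : T -> 'cV[R]_d).

(** The Gaussian likelihood without its normalising constant, in the shape [expR (- Q)] required by
    [is_derive_expint]. *)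
Definition gweight (S : 'M[R]_d) x w : R :=
  expR (- (1 / 2 * dot (x - X0 w) (invmx S *m (x - X0 w)))).

(* the posterior mean of [g (S^-1 (x - X0))] given [X0 + N(0, S) = x] *)
Definition mean (S : 'M[R]_d) x (g : 'cV[R]_d -> R) : R :=
  (\int[P]_w (g (invmx S *m (x - X0 w)) * gweight S x w)) / \int[P]_w gweight S x w.

End mean.

Section curve.
Context (R : realType) (dT : measure_display) (T : measurableType dT).
Variables (P : probability T R) (d : nat) (X0 : T -> 'cV[R]_d).
Hypothesis hX0 : forall i : 'I_d, measurable_fun setT (fun w => X0 w i 0).

Variables (x : 'cV[R]_d).

(** The growth scale [W] for the curve: centred at the fixed point [x], and shifted by 1 to satisfy
    [1 <= W]. *)
Definition sqweight w : R := 1 + \sum_i (x - X0 w) i 0 ^+ 2.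

Lemma sqweight_ge1 w : 1 <= sqweight w.
Proof. by rewrite lerDl sumr_ge0// => i _; exact: sqr_ge0. Qed.

Lemma poly_growth_coord i : poly_growth sqweight (fun w => (x - X0 w) i 0).
Proof.
exists 1%N, 1; split => // w; rewrite expr1 mul1r /sqweight.
have le1 (r : R) : `|r| <= 1 + r ^+ 2.
  by rewrite ler_norml; apply/andP; split; nra.
apply: (le_trans (le1 _)); rewrite lerD2l (bigD1 i)//= lerDl.
by apply: sumr_ge0 => j _; exact: sqr_ge0.
Qed.

Variables (S : R -> 'M[R]_d) (A : 'M[R]_d) (v : 'cV[R]_d).
Hypothesis hS : forall h, spd (S h).
Hypothesis hA : forall i j, is_derive (0 : R) (1 : R) (fun h => S h i j) (A i j).

Let B h := invmx (S h).
Let z h w := x + h *: v - X0 w.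
Let y h w := B h *m z h w.
Let adm := adm sqweight.

Let admE f df g dg : (forall h w, f h w = g h w) -> (forall w, df w = dg w) ->
  adm f df -> adm g dg.
Proof.
move=> fg dfg; have -> : f = g by apply/funext => h; apply/funext => w.
by have -> : df = dg by apply/funext.
Qed.

Let measurable_coord i : measurable_fun setT (fun w => (x - X0 w) i 0).
Proof.
under eq_fun do rewrite !mxE.
by apply: measurable_funB => //; exact: measurable_cst.
Qed.

Lemma adm_z i : adm (fun h w => z h w i 0) (fun=> v i 0).
Proof.
have H : is_derive (0 : R) (1 : R) (fun h => h * v i 0) (v i 0).
  have := @is_deriveM R R id (cst (v i 0)) 0 1 1 0 (is_derive_id _ _) (is_derive_cst _ _ _).
  by move/is_derive_eq; apply; rewrite scaler0 add0r [LHS]mulr1.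
have := admD sqweight_ge1 (adm_fixed (measurable_coord i) (poly_growth_coord i))
  (adm_cst sqweight H).
by apply: admE => [h w|w]; rewrite ?add0r// !mxE addrAC.
Qed.

Lemma adm_y i : adm (fun h w => y h w i 0)
  (fun w => (B 0 *m v - B 0 *m A *m y 0 w) i 0).
Proof.
have dB j := is_derive_invmx (fun h => spd_unitmx (hS h)) hA i j.
have := adm_sum sqweight_ge1 (fun j => admM sqweight_ge1 (adm_cst sqweight (dB j)) (adm_z j)).
apply: admE => [h w|w]; first by rewrite [RHS]mxE.
rewrite [RHS]mxE [X in _ = _ + X]mxE [X in _ = X - _]mxE /y mulmxA.
rewrite [X in _ = _ - X]mxE -sumrN -big_split/=.
by apply: eq_bigr => j _; rewrite mulNr.
Qed.

Lemma adm_dot_y a : adm (fun h w => dot a (y h w))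
  (fun w => dot a (B 0 *m v - B 0 *m A *m y 0 w)).
Proof.
have := adm_sum sqweight_ge1 (fun i =>
  admM sqweight_ge1 (adm_cst sqweight (is_derive_cst (a i 0) (0 : R) (1 : R))) (adm_y i)).
apply: admE => [h w|w] //.
by apply: eq_bigr => i _; rewrite mul0r addr0.
Qed.

(** Test functions of [y] that are integrable against the Gaussian weight. *)
Definition good_at (S1 : 'M[R]_d) (g : 'cV[R]_d -> R) :=
  measurable_fun setT (fun w => g (invmx S1 *m (x - X0 w))) /\
  poly_growth sqweight (fun w => g (invmx S1 *m (x - X0 w))).

Let z0 w : z 0 w = x - X0 w. Proof. by rewrite /z scale0r addr0. Qed.

Let y0 : y 0 = (fun w => B 0 *m (x - X0 w)).
Proof. by apply/funext => w; rewrite /y z0. Qed.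

Lemma good_dot a : good_at (S 0) (dot a).
Proof.
by have [/(_ 0) ma _ pa _] := adm_dot_y a; split; [move: ma|move: pa]; rewrite y0.
Qed.

(** Minus the logarithmic derivative of the weight along the curve at [h = 0], as a function of
    [u = y 0 w]. *)
Definition dquad (u : 'cV[R]_d) : R := dot v u - 1 / 2 * dot u (A *m u).

Let Q h w := 1 / 2 * dot (z h w) (B h *m z h w).

(** The product rule yields [v . y] twice with factor 1/2, once from the derivative of [z] and once
    from that of [y], since the symmetric [B 0] can be moved onto [z]. *)
Lemma adm_quad : adm Q (fun w => dquad (y 0 w)).
Proof.
have := admM sqweight_ge1 (adm_cst sqweight (is_derive_cst (1 / 2 : R) (0 : R) (1 : R)))
  (adm_sum sqweight_ge1 (fun i => admM sqweight_ge1 (adm_z i) (adm_y i))).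
apply: admE => [h w|w] //; rewrite mul0r addr0 big_split/= -/(dot _ _) -/(dot v _).
have zB u : dot (z 0 w) (B 0 *m u) = dot (y 0 w) u.
  by rewrite dot_mulmx (spd_inv_sym (hS 0)).
by rewrite dotBr -mulmxA !zB /dquad [dot _ v]dotC /cst; field.
Qed.

Lemma quad_coercive : exists lam K, 0 < lam /\
  \forall h \near (0 : R), forall w, lam * sqweight w - K <= Q h w.
Proof.
have ctr : {for (0 : R), continuous (fun h => \tr (S h))}.
  apply/differentiable_continuous/derivable1_diffP.
  by rewrite /mxtrace; apply: derivable_bigsum => i; have [] := hA i i.
pose C := \tr (S 0) + 1.
have C0 : 0 < C by rewrite ltr_wpDl// spd_tr_ge0.
pose V := \sum_i v i 0 ^+ 2.
(* With [|z|^2 <= C * (z . B z) = 2 * C * Q] and [|x - X0|^2 <= 2 * |z|^2 + 2 * V], one gets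
   [Q >= (|x - X0|^2 - 2 * V) / (4 * C)]; the 1 in [K] offsets the 1 in [sqweight]. *)
exists (1 / (4 * C)), ((1 + 2 * V) / (4 * C)); split; first by rewrite divr_gt0// mulr_gt0.
near=> h => w.
have h1 : `|h| <= 1 by near: h; exists 1 => //= t; rewrite /ball/= sub0r normrN => /ltW.
have trC : \tr (S h) <= C.
  near: h; move/cvgrPdist_le : ctr => /(_ 1 ltr01); apply: filterS => h.
  by rewrite distrC /C => /ler_normlW; lra.
have q0 : 0 <= dot (z h w) (B h *m z h w) by exact: spd_inv_ge0.
have H1 : \sum_i z h w i 0 ^+ 2 <= C * dot (z h w) (B h *m z h w).
  apply: le_trans (sum_sqr_le_spd_inv (hS h) _) _.
  by rewrite ler_wpM2r.
have H2 : \sum_i (x - X0 w) i 0 ^+ 2 <= 2 * (\sum_i z h w i 0 ^+ 2) + 2 * V.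
  rewrite /V !mulr_sumr -big_split/=; apply: ler_sum => i _.
  have -> : z h w i 0 = (x - X0 w) i 0 + h * v i 0 by rewrite !mxE addrAC.
  have h2 : h ^+ 2 <= 1 by rewrite -real_normK ?num_real// expr_le1.
  set p := (x - X0 w) i 0; set r := v i 0.
  have : h ^+ 2 * r ^+ 2 <= r ^+ 2 by rewrite ler_piMl// sqr_ge0.
  (* The identity used is [2 (p + h r)^2 + 2 r^2 - p^2 = (p + 2 h r)^2 + 2 (r^2 - h^2 r^2)]. *)
  have := sqr_ge0 (p + 2 * (h * r)).
  nra.
rewrite /Q /sqweight; set q := dot _ _ in H1 q0 *.
have -> : 1 / (4 * C) * (1 + \sum_i (x - X0 w) i 0 ^+ 2) - (1 + 2 * V) / (4 * C) =
  (\sum_i (x - X0 w) i 0 ^+ 2 - 2 * V) / (4 * C) by field; rewrite gt_eqF.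
by rewrite ler_pdivrMr ?mulr_gt0//; lra.
Unshelve. all: by end_near. Qed.

Lemma quad0_coercive : exists lam K, 0 < lam /\ forall w,
  lam * sqweight w - K <= 1 / 2 * dot (x - X0 w) (invmx (S 0) *m (x - X0 w)).
Proof.
have [lam [K [lam0 H]]] := quad_coercive; exists lam, K; split => // w.
by have := nbhs_singleton H => /(_ w); rewrite /Q z0.
Qed.

Lemma measurable_quad0 : measurable_fun setT
  (fun w => 1 / 2 * dot (x - X0 w) (invmx (S 0) *m (x - X0 w))).
Proof. by have [/(_ 0)] := adm_quad; rewrite /Q; under eq_fun do rewrite z0. Qed.

Lemma integrable_good g : good_at (S 0) g -> P.-integrable setT
  (EFin \o (fun w => g (invmx (S 0) *m (x - X0 w)) * gweight X0 (S 0) x w)).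
Proof.
move=> [mg pg]; have [lam [K [lam0 H]]] := quad0_coercive.
exact: (integrable_growth_exp P sqweight_ge1 lam0 mg pg measurable_quad0 H).
Qed.

Lemma integrable_gweight : P.-integrable setT (EFin \o gweight X0 (S 0) x).
Proof.
have : good_at (S 0) (fun=> 1).
  by split; [exact: measurable_cst|exact: poly_growth_cst].
by move/integrable_good; under eq_fun do rewrite mul1r.
Qed.

Lemma gweight_int_gt0 : 0 < \int[P]_w gweight X0 (S 0) x w.
Proof. by apply: Rintegral_gt0 integrable_gweight _ => w; exact: expR_gt0. Qed.

Lemma is_derive_gweight_int : good_at (S 0) dquad ->
  is_derive (0 : R) (1 : R) (fun h => \int[P]_w gweight X0 (S h) (x + h *: v) w)
   (- \int[P]_w (dquad (invmx (S 0) *m (x - X0 w)) * gweight X0 (S 0) x w)).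
Proof.
move=> gq; have [lam [K [lam0 H]]] := quad_coercive.
have D := is_derive_expint P sqweight_ge1 lam0
  (adm_cst sqweight (is_derive_cst (1 : R) (0 : R) (1 : R))) adm_quad H.
have E : (fun h => \int[P]_w (cst 1 h * expR (- Q h w))) =
    (fun h => \int[P]_w gweight X0 (S h) (x + h *: v) w).
  by apply/funext => h; apply: eq_Rintegral => w _; rewrite mul1r.
rewrite E in D; apply: (is_derive_eq D).
rewrite -mulN1r -RintegralZl//; last exact: integrable_good.
by apply: eq_Rintegral => w _; rewrite y0 /Q z0 /cst /gweight /B/=; ring.
Qed.

(** Quotient rule: the denominator has derivative minus the integral of [dquad] against the weight,
    whence the product of means with a plus sign. Here [dg] is the derivative of [g (y h w)] in [h],
    expressed through [y 0 w]. *)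
Lemma is_derive_mean g dg : good_at (S 0) dquad ->
  adm (fun h w => g (y h w)) (fun w => dg (y 0 w)) ->
  is_derive (0 : R) (1 : R) (fun h => mean P X0 (S h) (x + h *: v) g)
    (mean P X0 (S 0) x (fun u => dg u - g u * dquad u)
     + mean P X0 (S 0) x g * mean P X0 (S 0) x dquad).
Proof.
move=> gq ag; have [lam [K [lam0 H]]] := quad_coercive.
have DN := is_derive_expint P sqweight_ge1 lam0 ag adm_quad H.
have DD := is_derive_gweight_int gq.
have D0 := gweight_int_gt0.
have DV : is_derive (0 : R) (1 : R)
    (fun h => (\int[P]_w gweight X0 (S h) (x + h *: v) w)^-1)
    (\int[P]_w (dquad (invmx (S 0) *m (x - X0 w)) * gweight X0 (S 0) x w) /
     (\int[P]_w gweight X0 (S 0) x w) ^+ 2).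
  have n0 : \int[P]_w gweight X0 (S 0) (x + 0 *: v) w != 0.
    by rewrite scale0r addr0 gt_eqF.
  have [dD vD] := DD.
  apply: DeriveDef; first exact: derivableV.
  by rewrite deriveV// vD scale0r addr0 scalerN scaleNr opprK [LHS]mulrC.
apply: (is_derive_eq (is_deriveM DN DV)).
rewrite /mean !y0 /Q scale0r addr0 /GRing.scale/=.
have -> : (fun w => g (B 0 *m (x - X0 w)) * expR (- (1 / 2 * dot (z 0 w) (B 0 *m z 0 w))))
  = (fun w => g (invmx (S 0) *m (x - X0 w)) * gweight X0 (S 0) x w).
  by apply/funext => w; rewrite z0.
have -> : (fun w => (dg (B 0 *m (x - X0 w)) - g (B 0 *m (x - X0 w)) * dquad (B 0 *m (x - X0 w)))
    * expR (- (1 / 2 * dot (z 0 w) (B 0 *m z 0 w))))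
  = (fun w => (dg (invmx (S 0) *m (x - X0 w)) - g (invmx (S 0) *m (x - X0 w)) *
     dquad (invmx (S 0) *m (x - X0 w))) * gweight X0 (S 0) x w).
  by apply/funext => w; rewrite z0.
by field; rewrite gt_eqF.
Qed.

End curve.

(** * Posterior moments and the score *)

(** The two difference quotients coincide. Every directional derivative, in [x] or in the parameter,
    thus becomes a derivative at 0 along a curve. *)
Lemma is_derive_line (R : realType) (V W : normedModType R) (f : V -> W)
  (x v : V) (df : W) :
  is_derive (0 : R) (1 : R) (fun h => f (x + h *: v)) df <-> is_derive x v f df.
Proof.
have E : (fun h : R => h^-1 *: (((fun k => f (x + k *: v)) \o shift 0) (h *: 1)
      - f (x + 0 *: v))) =
    (fun h => h^-1 *: ((f \o shift x) (h *: v) - f x)).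
  apply/funext => h /=; rewrite scale0r !addr0 [x + _]addrC.
  by have -> : h *: (1 : R) = h := mulr1 h.
by split=> -[D <-]; apply: DeriveDef; move: D; rewrite /derivable /derive -?E.
Qed.

Lemma is_derive_col (R : realType) (V : normedModType R) n (G : V -> 'cV[R]_n)
  (x v : V) (dG : 'I_n -> R) :
  (forall i, is_derive x v (fun t => G t i 0) (dG i)) ->
  is_derive x v G (\col_i dG i).
Proof.
move=> H; have D : derivable G x v.
  by apply/derivable_mxP => i j; rewrite (ord1 j); have [] := H i.
apply: DeriveDef => //; rewrite derive_mx//; apply/matrixP => i j.
by rewrite !mxE (ord1 j); have [] := H i.
Qed.

Section moments.
Context (R : realType) (dT : measure_display) (T : measurableType dT).
Variables (P : probability T R) (d : nat) (X0 : T -> 'cV[R]_d).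
Hypothesis hX0 : forall i : 'I_d, measurable_fun setT (fun w => X0 w i 0).

Section fixed_covariance.
Variable S : 'M[R]_d.
Hypothesis hS : spd S.

(** The constant curve, with zero velocity, specialises the previous section to spatial
    derivatives. *)
Let hcS : forall h : R, spd S. Proof. by []. Qed.

Let hcA (i j : 'I_d) : is_derive (0 : R) (1 : R) (fun=> S i j) ((0 : 'M[R]_d) i j).
Proof. by rewrite mxE; exact: is_derive_cst. Qed.

Section fixed_point.
Variable x : 'cV[R]_d.
Let good := good_at X0 x S.
Let m := mean P X0 S x.

Lemma good_lin a : good (dot a).
Proof. exact: (good_dot hX0 x 0 hcS hcA a). Qed.

Lemma good_cst k : good (fun=> k).
Proof. by split; [exact: measurable_cst|exact: poly_growth_cst]. Qed.

Lemma goodD f g : good f -> good g -> good (fun u => f u + g u).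
Proof.
move=> [mf pf] [mg pg]; split; first exact: measurable_funD.
exact: (poly_growthD (sqweight_ge1 X0 x) pf pg).
Qed.

Lemma goodM f g : good f -> good g -> good (fun u => f u * g u).
Proof.
move=> [mf pf] [mg pg]; split; first exact: measurable_funM.
exact: (poly_growthM pf pg).
Qed.

Lemma goodZ k f : good f -> good (fun u => k * f u).
Proof. by apply: goodM; exact: good_cst. Qed.

Lemma good_sum n (f : 'I_n -> 'cV[R]_d -> R) : (forall i, good (f i)) ->
  good (fun u => \sum_i f i u).
Proof.
elim: n f => [|n IH] f gf.
  by under eq_fun do rewrite big_ord0; exact: good_cst.
by under eq_fun do rewrite big_ord_recr/=; apply: goodD => //; exact: IH.
Qed.

Let int_gt0 : 0 < \int[P]_w gweight X0 S x w.
Proof. exact: (gweight_int_gt0 P hX0 x 0 hcS hcA). Qed.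

Let integrable_of_good g : good g -> P.-integrable setT
  (EFin \o (fun w => g (invmx S *m (x - X0 w)) * gweight X0 S x w)).
Proof. by move=> gg; exact: (integrable_good P hX0 0 hcS hcA). Qed.

Lemma mean_cst k : m (fun=> k) = k.
Proof.
rewrite /m /mean RintegralZl ?mulfK ?gt_eqF//.
exact: (integrable_gweight P hX0 x 0 hcS hcA).
Qed.

Lemma meanD f g : good f -> good g -> m (fun u => f u + g u) = m f + m g.
Proof.
move=> gf gg; rewrite /m /mean -mulrDl -RintegralD//; try exact: integrable_of_good.
by congr (_ / _); apply: eq_Rintegral => w _; rewrite mulrDl.
Qed.

Lemma meanZ k f : good f -> m (fun u => k * f u) = k * m f.
Proof.
move=> gf; rewrite /m /mean mulrA -RintegralZl//; last exact: integrable_of_good.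
by congr (_ / _); apply: eq_Rintegral => w _; rewrite mulrA.
Qed.

Lemma mean_sum n (f : 'I_n -> 'cV[R]_d -> R) : (forall i, good (f i)) ->
  m (fun u => \sum_i f i u) = \sum_i m (f i).
Proof.
elim: n f => [|n IH] f gf.
  by under eq_fun do rewrite big_ord0; rewrite big_ord0 mean_cst.
under eq_fun do rewrite big_ord_recr/=; rewrite big_ord_recr/= meanD ?IH//.
exact: good_sum.
Qed.

(** Moment tensors of [y] are represented by their contractions with vectors, so that linearity in
    each slot replaces index manipulations. *)
Definition mom1 a := m (dot a).
Definition mom2 a b := m (fun u => dot a u * dot b u).
Definition mom3 a b c := m (fun u => dot a u * dot b u * dot c u).

Lemma mom2C a b : mom2 a b = mom2 b a.
Proof. by rewrite /mom2; under eq_fun do rewrite mulrC. Qed.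

Lemma mom3AC a b c : mom3 a b c = mom3 a c b.
Proof. by rewrite /mom3; under eq_fun do rewrite mulrAC. Qed.

Lemma mom1_lin n (k : 'I_n -> R) (b : 'I_n -> 'cV[R]_d) :
  mom1 (\sum_i k i *: b i) = \sum_i k i * mom1 (b i).
Proof.
have -> : mom1 (\sum_i k i *: b i) = m (fun u => \sum_i k i * dot (b i) u).
  congr (m _); apply/funext => u; rewrite dotC dot_sumr.
  by apply: eq_bigr => i _; rewrite dotZr dotC.
rewrite mean_sum => [|i]; last exact/goodZ/good_lin.
by apply: eq_bigr => i _; rewrite meanZ//; exact: good_lin.
Qed.

Lemma mom2_lin a n (k : 'I_n -> R) (b : 'I_n -> 'cV[R]_d) :
  mom2 a (\sum_i k i *: b i) = \sum_i k i * mom2 a (b i).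
Proof.
have -> : mom2 a (\sum_i k i *: b i) = m (fun u => \sum_i k i * (dot a u * dot (b i) u)).
  congr (m _); apply/funext => u; rewrite [X in _ * X]dotC dot_sumr mulr_sumr.
  by apply: eq_bigr => i _; rewrite dotZr [dot u _]dotC mulrCA.
have gab i : good (fun u => dot a u * dot (b i) u) by apply: goodM; exact: good_lin.
rewrite mean_sum => [|i]; last exact/goodZ.
by apply: eq_bigr => i _; rewrite meanZ.
Qed.

(** Splitting the form into products of linear forms expresses its mean through [mom2]. *)
Lemma quad_form_sum (A : 'M[R]_d) u :
  dot u (A *m u) = \sum_k dot (stdb R k) u * dot (A^T *m stdb R k) u.
Proof. by apply: eq_bigr => k _; rewrite -dot_mulmx !dot_stdb. Qed.

Lemma good_quad (A : 'M[R]_d) : good (fun u => dot u (A *m u)).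
Proof.
under eq_fun do rewrite quad_form_sum.
by apply: good_sum => k; apply: goodM; exact: good_lin.
Qed.

Lemma good_dquad A v : good (dquad A v).
Proof.
rewrite /dquad; under eq_fun do rewrite -mulNr.
by apply: goodD; [exact: good_lin|exact/goodZ/good_quad].
Qed.

Lemma dquad0 (v : 'cV[R]_d) : dquad 0 v = dot v.
Proof. by apply/funext => u; rewrite /dquad mul0mx dot0r mulr0 subr0. Qed.

End fixed_point.

(** With [A = 0], [dquad] is [dot v] and [dot a y] has the constant derivative
    [dot a (invmx S *m v)]; the rest is minus the posterior covariance of [a . y] and [v . y]. *)
Lemma is_derive_mom1 x a v :
  is_derive x v (fun y => mom1 y a)
    (dot a (invmx S *m v) - mom2 x a v + mom1 x a * mom1 x v).
Proof.
apply/is_derive_line.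
have := is_derive_mean P hX0 (x := x) (v := v) hcS hcA (g := dot a)
  (dg := fun=> dot a (invmx S *m v)) (good_dquad _ _ _).
move=> /(_ _)/is_derive_eq; apply.
  have := adm_dot_y hX0 x v hcS hcA a.
  by rewrite mulmx0; under [X in adm _ _ X]eq_fun do rewrite mul0mx subr0.
rewrite dquad0; congr (_ + _).
have -> : (fun u => dot a (invmx S *m v) - dot a u * dot v u) =
    (fun u => dot a (invmx S *m v) + -1 * (dot a u * dot v u)).
  by apply/funext => u; rewrite mulN1r.
have gav : good_at X0 x S (fun u => dot a u * dot v u).
  by apply: goodM; exact: good_lin.
by rewrite meanD ?meanZ ?mean_cst ?mulN1r//; [exact: good_cst|exact: goodZ].
Qed.

Lemma is_derive_mom2 x a b v :
  is_derive x v (fun y => mom2 y a b)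
    (dot a (invmx S *m v) * mom1 x b + dot b (invmx S *m v) * mom1 x a
     - mom3 x a b v + mom2 x a b * mom1 x v).
Proof.
apply/is_derive_line.
have := is_derive_mean P hX0 (x := x) (v := v) hcS hcA (g := fun u => dot a u * dot b u)
  (dg := fun u => dot a u * dot b (invmx S *m v) + dot a (invmx S *m v) * dot b u)
  (good_dquad _ _ _).
move=> /(_ _)/is_derive_eq; apply.
  have Ha := adm_dot_y hX0 x v hcS hcA a.
  have Hb := adm_dot_y hX0 x v hcS hcA b.
  have := admM (sqweight_ge1 X0 x) Ha Hb; rewrite mulmx0.
  by under [X in adm _ _ X]eq_fun do rewrite mul0mx subr0.
rewrite dquad0; congr (_ + _).
set ka := dot a (_ *m v); set kb := dot b (_ *m v).
have -> : (fun u => dot a u * kb + ka * dot b u - dot a u * dot b u * dot v u) =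
    (fun u => kb * dot a u + ka * dot b u + -1 * (dot a u * dot b u * dot v u)).
  by apply/funext => u; ring.
have gabv : good_at X0 x S (fun u => dot a u * dot b u * dot v u).
  by do 2 (apply: goodM; last exact: good_lin); exact: good_lin.
rewrite meanD; last 2 first.
- by apply: goodD; apply/goodZ/good_lin.
- exact: goodZ.
rewrite meanD; [|exact/goodZ/good_lin|exact/goodZ/good_lin].
by rewrite !meanZ//; try exact: good_lin; rewrite /mom1 /mom3 addrC; ring.
Qed.

End fixed_covariance.

(** With [v = 0], the derivative of [y] is [- B A y], and symmetry moves [B A] onto [a] as [A B];
    [dquad] is [- (y . A y) / 2], which contributes the third and second moments. *)
Lemma is_derive_mom1_cov (S : R -> 'M[R]_d) (A : 'M[R]_d) x a :
  (forall h, spd (S h)) -> A^T = A ->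
  (forall i j, is_derive (0 : R) (1 : R) (fun h => S h i j) (A i j)) ->
  is_derive (0 : R) (1 : R) (fun h => mom1 (S h) x a)
    (- mom1 (S 0) x (A *m invmx (S 0) *m a)
     + 1 / 2 * \sum_k mom3 (S 0) x a (stdb R k) (A *m stdb R k)
     - 1 / 2 * (mom1 (S 0) x a * \sum_k mom2 (S 0) x (stdb R k) (A *m stdb R k))).
Proof.
move=> hS symA hA.
have E : (fun h => mom1 (S h) x a) = (fun h => mean P X0 (S h) (x + h *: 0) (dot a)).
  by apply/funext => h; rewrite scaler0 addr0.
have ag := adm_dot_y hX0 x 0 hS hA a.
rewrite E {E}; apply: (is_derive_eq (is_derive_mean P hX0 (x := x) (v := 0) hS hA
  (g := dot a) (dg := fun u => dot a (invmx (S 0) *m 0 - invmx (S 0) *m A *m u))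
  (good_dquad (hS 0) _ _ _) ag)).
have dqE : dquad A 0 = (fun u => - (1 / 2) * \sum_k dot (stdb R k) u * dot (A *m stdb R k) u).
  apply/funext => u; rewrite /dquad [dot 0 u]dotC dot0r sub0r quad_form_sum symA.
  by rewrite mulNr.
have gl := fun b => good_lin (hS 0) x b.
have g2 k : good_at X0 x (S 0) (fun u => dot (stdb R k) u * dot (A *m stdb R k) u).
  exact: goodM.
have g3 k : good_at X0 x (S 0) (fun u => dot a u * dot (stdb R k) u * dot (A *m stdb R k) u).
  by apply: goodM => //; exact: goodM.
have -> : (fun u => dot a (invmx (S 0) *m 0 - invmx (S 0) *m A *m u) - dot a u * dquad A 0 u) =
   (fun u => -1 * dot (A *m invmx (S 0) *m a) u +
     1 / 2 * \sum_k dot a u * dot (stdb R k) u * dot (A *m stdb R k) u).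
  apply/funext => u; rewrite mulmx0 sub0r dotNr mulN1r dqE; congr (- _ + _).
    by rewrite dot_mulmx trmx_mul symA spd_inv_sym.
  rewrite mulNr mulrN opprK mulrCA mulr_sumr; congr (_ * _).
  by apply: eq_bigr => k _; rewrite mulrA.
rewrite meanD//; last 2 first.
- exact: goodZ.
- by apply: goodZ; exact: good_sum.
rewrite dqE !meanZ//; try exact: good_sum.
by rewrite (mean_sum (hS 0) g3) (mean_sum (hS 0) g2) /mom1 /mom2 /mom3; ring.
Qed.

Lemma conv_gaussE (S : 'M[R]_d) x : spd S ->
  conv_gauss P X0 S x =
  (\int[P]_w gweight X0 S x w) * (Num.sqrt ((2 * pi) ^+ d * \det S))^-1.
Proof.
move=> hS; rewrite /conv_gauss -RintegralZr//.
  by apply: eq_Rintegral => w _; rewrite /gauss_density /gweight quadE mulNr.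
apply: (integrable_gweight P hX0 x (S := fun=> S) (A := 0) 0) => // i j.
by rewrite mxE; exact: is_derive_cst.
Qed.

(* the normalising constant does not depend on the point, so it drops out *)
Lemma scoreE (S : 'M[R]_d) x : spd S ->
  score (conv_gauss P X0 S) x = \col_i (- mom1 S x (stdb R i)).
Proof.
move=> hS; apply/matrixP => i j; rewrite !mxE {j}.
have hcA (k l : 'I_d) : is_derive (0 : R) (1 : R) (fun=> S k l) ((0 : 'M[R]_d) k l).
  by rewrite mxE; exact: is_derive_cst.
have I0 y := gweight_int_gt0 P hX0 y (S := fun=> S) 0 (fun=> hS) hcA.
(* Positivity of the constant, hence of [\det S], lets [ln] turn the product into a sum. *)
have c0 : 0 < (Num.sqrt ((2 * pi) ^+ d * \det S))^-1.
  by rewrite invr_gt0 sqrtr_gt0 mulr_gt0 ?spd_det_gt0// exprn_gt0// mulr_gt0 ?pi_gt0.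
have -> : (fun y => ln (conv_gauss P X0 S y)) =
   (fun y => ln (\int[P]_w gweight X0 S y w) + ln (Num.sqrt ((2 * pi) ^+ d * \det S))^-1).
  by apply/funext => y; rewrite conv_gaussE// lnM// posrE.
suff [] : is_derive x (stdb R i)
   (fun y => ln (\int[P]_w gweight X0 S y w) + ln (Num.sqrt ((2 * pi) ^+ d * \det S))^-1)
   (- mom1 S x (stdb R i)) by [].
apply/is_derive_line.
have DI := is_derive_gweight_int P hX0 (x := x) (v := stdb R i) (fun=> hS) hcA
  (good_dquad hS _ _ _).
have Dl : is_derive (\int[P]_w gweight X0 S (x + 0 *: stdb R i) w) (1 : R) (@ln R)
   (\int[P]_w gweight X0 S (x + 0 *: stdb R i) w)^-1 by exact: is_derive1_ln.
have DC := is_derive1_comp Dl DI.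
apply: (is_derive_eq (is_deriveD DC (is_derive_cst _ _ _))).
by rewrite addr0 dquad0 scale0r addr0 /mom1 /mean mulrC mulNr.
Qed.

End moments.

(** * The identity *)

Lemma derive1_line (R : realType) (V W : normedModType R) (f : V -> W)
  (x v : V) (df : W) :
  is_derive x v f df -> derive1 (fun s : R => f (x + s *: v)) 0 = df.
Proof. by move=> /is_derive_line[_ <-]; rewrite derive1E. Qed.

Section score.
Context (R : realType) (dT : measure_display) (T : measurableType dT).
Variables (P : probability T R) (d : nat) (X0 : T -> 'cV[R]_d).
Hypothesis hX0 : forall i : 'I_d, measurable_fun setT (fun w => X0 w i 0).
Variables (S A : 'M[R]_d).
Hypotheses (hS : spd S) (symA : A^T = A).

Let m1 := mom1 P X0 S.
Let m2 := mom2 P X0 S.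
Let m3 := mom3 P X0 S.
Let e := @stdb R d.
Let G := score (conv_gauss P X0 S).

(** The Hessian of the log-density at [y], contracted with [a] and [v]. *)
Let dscore a v y := - (dot a (invmx S *m v) - m2 y a v + m1 y a * m1 y v).

Let is_derive_score y v : is_derive y v G (\col_i dscore (e i) v y).
Proof.
have -> : G = (fun y => \col_i (- m1 y (e i))).
  by apply/funext => u; rewrite /G scoreE.
apply: is_derive_col => i; under eq_fun do rewrite mxE.
exact: (is_deriveN (is_derive_mom1 P hX0 hS y (e i) v)).
Qed.

(** The terms in [invmx S] cancel, leaving minus the third posterior cumulant of [y]. *)
Let is_derive_dscore x a b v : is_derive x b (dscore a v)
  (- m3 x a b v + m2 x a v * m1 x b + m2 x a b * m1 x v + m1 x a * m2 x b v
   - 2 * (m1 x a * (m1 x b * m1 x v))).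
Proof.
have D2 := is_derive_mom2 P hX0 hS x a v b.
have Da := is_derive_mom1 P hX0 hS x a b.
have Dv := is_derive_mom1 P hX0 hS x v b.
have := is_deriveN (is_deriveD (is_deriveB
  (is_derive_cst (dot a (invmx S *m v)) x b) D2) (is_deriveM Da Dv)).
move/is_derive_eq; apply.
rewrite /GRing.scale/= -/m1 -/m2 -/m3 (_ : m3 x a v b = m3 x a b v); last exact: mom3AC.
by rewrite (_ : m2 x v b = m2 x b v); [ring|exact: mom2C].
Qed.

(** The first part of [rhs] contracts the third cumulant with [A]; the second is the Hessian in
    direction [A *m G x], where [G x] is minus the mean of [y]. The products of three first moments
    cancel between the two parts, and so do the products of [m2 x (e i) _] with a first moment. *)
Lemma rhs_score x : rhs G A x = \col_i
  (m1 x (A *m invmx S *m e i) - 1 / 2 * \sum_k m3 x (e i) (e k) (A *m e k)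
   + 1 / 2 * (m1 x (e i) * \sum_k m2 x (e k) (A *m e k))).
Proof.
have GE : A *m G x = \sum_k (- m1 x (e k)) *: (A *m e k).
  rewrite [G x](sum_dot_stdb (G x)) mulmx_sumr; apply: eq_bigr => k _.
  by rewrite -scalemxAr dotC dot_stdb /G scoreE// mxE.
transitivity (1 / 2 *: (\sum_(k < d) \col_i (- m3 x (e i) (e k) (A *m e k)
     + m2 x (e i) (A *m e k) * m1 x (e k) + m2 x (e i) (e k) * m1 x (A *m e k)
     + m1 x (e i) * m2 x (e k) (A *m e k)
     - 2 * (m1 x (e i) * (m1 x (e k) * m1 x (A *m e k)))))
   + \col_i dscore (e i) (A *m G x) x).
  rewrite /rhs; congr (_ *: _ + _); last exact: derive1_line.
  apply: eq_bigr => k _.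
  transitivity (derive1 (fun r : R => \col_i dscore (e i) (A *m e k) (x + r *: e k)) 0).
    by congr (derive1 _ 0); apply/funext => r; exact: derive1_line.
  apply: (@derive1_line _ _ _ (fun y => \col_i dscore (e i) (A *m e k) y)).
  by apply: is_derive_col => i; under eq_fun do rewrite mxE.
apply/matrixP => i j; rewrite (ord1 j) {j} !mxE summxE.
under eq_bigr do rewrite mxE.
rewrite !big_split/= !sumrN -!mulr_sumr.
have linA k : A *m e k = \sum_l dot (A *m e k) (e l) *: e l by exact: sum_dot_stdb.
have dotA k l : dot (A *m e k) (e l) = dot (A *m e l) (e k).
  by rewrite dotC dot_mulmx symA.
(* Expanding [A *m e k] in the basis and exchanging the sums transposes [A], which is symmetric; two
   cumulant terms thus coincide. *)
have -> : \sum_k m2 x (e i) (e k) * m1 x (A *m e k) =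
          \sum_k m2 x (e i) (A *m e k) * m1 x (e k).
  transitivity (\sum_k \sum_l dot (A *m e k) (e l) * (m2 x (e i) (e k) * m1 x (e l))).
    apply: eq_bigr => k _; rewrite {1}linA /m1 mom1_lin// mulr_sumr.
    by apply: eq_bigr => l _; rewrite mulrCA.
  rewrite exchange_big/=; apply: eq_bigr => l _.
  rewrite {1}linA /m2 mom2_lin// mulr_suml.
  by apply: eq_bigr => k _; rewrite mulrA dotA.
rewrite /dscore GE.
have -> : m1 x (\sum_k - m1 x (e k) *: (A *m e k)) =
    - \sum_k m1 x (e k) * m1 x (A *m e k).
  by rewrite {1}/m1 mom1_lin// -sumrN; apply: eq_bigr => k _; rewrite mulNr.
have -> : m2 x (e i) (\sum_k - m1 x (e k) *: (A *m e k)) =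
    - \sum_k m2 x (e i) (A *m e k) * m1 x (e k).
  by rewrite {1}/m2 mom2_lin// -sumrN; apply: eq_bigr => k _; rewrite mulNr mulrC.
have -> : dot (e i) (invmx S *m (\sum_k - m1 x (e k) *: (A *m e k))) =
    - m1 x (A *m invmx S *m e i).
  rewrite (sum_dot_stdb (A *m invmx S *m e i)) {2}/m1 mom1_lin// mulmx_sumr dot_sumr -sumrN.
  apply: eq_bigr => k _; rewrite -scalemxAr dotZr mulNr mulrC; congr (- (_ * _)).
  by rewrite mulmxA dot_mulmx trmx_mul symA spd_inv_sym.
by field.
Qed.

End score.

Unset Implicit Arguments. Set Strict Implicit.

Theorem theorem1 (R : realType) (dT : measure_display) (T : measurableType dT)
  (P : probability T R) (d c : nat) (X0 : T -> 'cV[R]_d)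
  (hX0 : forall i : 'I_d, measurable_fun setT (fun w => X0 w i 0))
  (M : R -> 'cV[R]_c -> 'M[R]_d) (t : R) (ht : 0 < t)
  (hspd : forall th : 'cV[R]_c, spd (M t th))
  (hdiff : forall th : 'cV[R]_c, differentiable (M t) th) :
  (forall (j : 'I_c) (th : 'cV[R]_c) (x : 'cV[R]_d),
     'D_(stdb R j) (fun th' => score (conv_gauss P X0 (M t th')) x) th
     = rhs (score (conv_gauss P X0 (M t th))) ('D_(stdb R j) (M t) th) x)
  /\
  (forall (Tend : R) (Phi : Type) (s : 'cV[R]_d -> R -> Phi -> 'cV[R]_d)
          (phistar : 'cV[R]_c -> Phi),
     t <= Tend ->
     (forall th, M 0 th = 0) ->
     (forall th (u : R), 0 <= u <= Tend -> spd (derive1 (fun v => M v th) u)) ->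
     (forall th x, s x t (phistar th) = score (conv_gauss P X0 (M t th)) x) ->
     forall (j : 'I_c) (th : 'cV[R]_c) (x : 'cV[R]_d),
       'D_(stdb R j) (fun th' => s x t (phistar th')) th
       = rhs (fun y => s y t (phistar th)) ('D_(stdb R j) (M t) th) x).
Proof.
have main (j : 'I_c) (th : 'cV[R]_c) (x : 'cV[R]_d) :
     'D_(stdb R j) (fun th' => score (conv_gauss P X0 (M t th')) x) th
     = rhs (score (conv_gauss P X0 (M t th))) ('D_(stdb R j) (M t) th) x.
  have D : derivable (M t) th (stdb R j) by exact: diff_derivable.
  have := derive_mx D; move: ('D_(stdb R j) (M t) th) => A AE.
  have Aij i k : A i k = 'D_(stdb R j) (fun th => M t th i k) th by rewrite AE mxE.
  (* The matrices [M t th'] are all symmetric, so the opposite entries are the same function of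
     [th'] and have equal derivatives. *)
  have symA : A^T = A.
    apply/matrixP => i k; rewrite mxE !Aij.
    suff -> : (fun th => M t th i k) = (fun th => M t th k i) by [].
    by apply/funext => th'; have [E _] := hspd th'; rewrite -{1}E mxE.
  (* The covariance curve through [M t th] in the [j]-th parameter direction, with velocity [A] at
     0. *)
  pose S h := M t (th + h *: stdb R j).
  have S0 : S 0 = M t th by rewrite /S scale0r addr0.
  have hA i k : is_derive (0 : R) (1 : R) (fun h => S h i k) (A i k).
    apply/(is_derive_line (fun th => M t th i k)); apply: DeriveDef.
      by move/derivable_mxP : D; apply.
    by rewrite Aij.
  rewrite rhs_score//.
  have [_ <-] // : is_derive th (stdb R j)
    (fun th' => score (conv_gauss P X0 (M t th')) x) (\col_i
      (mom1 P X0 (M t th) x (A *m invmx (M t th) *m stdb R i)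
       - 1 / 2 * \sum_k mom3 P X0 (M t th) x (stdb R i) (stdb R k) (A *m stdb R k)
       + 1 / 2 * (mom1 P X0 (M t th) x (stdb R i) *
                  \sum_k mom2 P X0 (M t th) x (stdb R k) (A *m stdb R k)))).
  apply/is_derive_line; apply: is_derive_col => i.
  under eq_fun do rewrite scoreE// mxE.
  have := is_deriveN (is_derive_mom1_cov P hX0 (S := S) x (stdb R i) (fun h => hspd _) symA hA).
  by move/is_derive_eq; apply; rewrite S0; ring.
(* The equality of [s] at [phistar] with the score holds for all parameters and points, so it may be
   substituted under both kinds of derivative. *)
split=> // Tend Phi s phistar _ _ _ sE j th x.
have -> : (fun y => s y t (phistar th)) = score (conv_gauss P X0 (M t th)).
  by apply/funext => y.
by rewrite -main; congr ('D__ _ _); apply/funext => th'.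
Qed.
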